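(* Let $T$ be a tournament of order $n\geq 3$. If $\gamma(T)>1$, then $w(T)=\gamma(T)$ or $w(T)=\gamma(T)+1$.
   Context: A tournament is an orientation of a finite complete graph; its order is its number of vertices. A set $S$ of vertices is dominating if every vertex is in $S$ or is an out-neighbour of a vertex in $S$; $\gamma(T)$ is the minimum size of a dominating set. A walk follows the direction of arcs and may repeat vertices and arcs; its length is the number of arcs traversed (counted with repetition); a single vertex is a closed walk of length $0$. A closed dominating walk is a closed walk whose vertex set is dominating. A watchman's walk is a closed dominating walk of minimum length, and $w(T)$ (the watchman number) is this minimum length. Every tournament has a closed dominating walk, so $w(T)$ is well defined. *)

(* Defs.v *)
From mathcomp Require Import all_boot.

Set Implicit Arguments.
Unset Strict Implicit.
Unset Printing Implicit Defensive.

(* [arc x y] means that the arc between x and y is directed from x to y.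
   Tournaments have at least one vertex: an empty one has no closed walk, not
   even of length 0. *)
Record tournament := Tournament {
  vertex :> finType;
  arc : rel vertex;
  arc_irr : irreflexive arc;
  arc_orient : forall x y, x != y -> arc x y (+) arc y x;
  vertex_gt0 : 0 < #|vertex|
}.

Section Watchman.
Variable T : tournament.

Definition dominating (S : {set T}) : bool :=
  [forall v, (v \in S) || [exists u in S, arc u v]].

(* The default [set: T] is dominating, so this is a minimum over all
   dominating sets. *)
Definition domination_number : nat :=
  #|[arg min_(S < [set: T] | dominating S) #|S| ]|.

(* The pair (x, p) encodes the walk x :: p, whose length is [size p]. *)
Definition closed_walk (x : T) (p : seq T) : bool :=
  path (@arc T) x p && (last x p == x).

Definition closed_dominating_walk (x : T) (p : seq T) : bool :=
  closed_walk x p && dominating [set v in x :: p].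

Definition has_closed_dominating_walk (k : nat) : bool :=
  [exists x : T, exists p : k.-tuple T, closed_dominating_walk x p].

(* A vertex x with the most reachable vertices reaches every vertex; a closed
   walk from x through all the vertices that reach x is dominating. *)
Lemma ex_closed_dominating_walk : exists k, has_closed_dominating_walk k.
Proof.
have /card_gt0P[x0 _] := vertex_gt0 T.
pose R x := [set y | connect (@arc T) x y].
have [x _ xmax] := @arg_maxnP T x0 predT (fun x => #|R x|) isT.
have reach y : connect (@arc T) x y.
  apply/negPn/negP => nxy.
  have neq : x != y by apply: contraNneq nxy => ->; exact: connect0.
  have ayx : arc y x.
    have := arc_orient neq; case: (boolP (arc x y)) => [axy|//].
    by case/negP: nxy; exact: connect1.
  have : R x \proper R y.
    rewrite properE; apply/andP; split.
      apply/subsetP => z; rewrite !inE; exact: connect_trans (connect1 ayx).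
    by apply/subsetPn; exists y; rewrite inE ?connect0.
  by move/proper_card; rewrite ltnNge; have := xmax y isT; rewrite /= => ->.
have [p cp sp] : exists2 p, closed_walk x p
    & {subset [seq v <- enum T | connect (@arc T) v x] <= x :: p}.
  elim: (enum T) => [|v s [p /andP[pp /eqP lp] sp]].
    by exists [::] => [|z]; rewrite ?/closed_walk /= ?eqxx ?in_nil.
  case: (boolP (connect (@arc T) v x)) => [vx|nvx]; last first.
    by exists p; rewrite ?/closed_walk ?pp ?lp ?eqxx //= (negPf nvx).
  have /connectP[q1 pq1 lq1] := reach v.
  have /connectP[q2 pq2 lq2] := vx.
  exists (p ++ q1 ++ q2).
    by rewrite /closed_walk !cat_path !last_cat pp lp pq1 -lq1 pq2 -lq2 /=.
  rewrite /= vx => z; rewrite inE => /predU1P[->|/sp].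
    have := mem_last x q1; rewrite -lq1 !inE !mem_cat.
    by case/orP=> ->; rewrite ?orbT.
  by rewrite !inE !mem_cat; case/orP=> ->; rewrite ?orbT.
exists (size p); apply/existsP; exists x; apply/existsP; exists (in_tuple p).
rewrite /closed_dominating_walk cp /=; apply/forallP => y.
case: (boolP (connect (@arc T) y x)) => [yx|nyx].
  by rewrite inE sp // mem_filter yx mem_enum.
apply/orP; right; apply/existsP; exists x; rewrite !inE eqxx /=.
have neq : x != y by apply: contraNneq nyx => ->; exact: connect0.
have := arc_orient neq; case: (boolP (arc y x)) => [ayx|]; last by rewrite addbF.
by case/negP: nyx; exact: connect1.
Qed.

Definition watchman_number : nat := ex_minn ex_closed_dominating_walk.

End Watchman.

(* Main.v *)
(** A tournament has a Hamiltonian path on any set of vertices, in particular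
    on a minimum dominating set D, say from u to v.  If v -> u this path closes
    up to a cycle of length |D|.  If u -> v, some x has v -> x -> u, which closes
    the path up with |D| + 1 arcs: otherwise u would dominate v and everything
    v dominates, and D \ v would be a smaller dominating set. *)

From mathcomp Require Import all_boot.
Require Import Defs.

Section TournamentWalks.
Variable T : tournament.
Implicit Types (x y u v : T) (s p : seq T) (S : {set T}).

Lemma arc_asym x y : arc x y -> ~~ arc y x.
Proof.
move=> axy; have neq : x != y by apply: contraTneq axy => ->; rewrite arc_irr.
by have := arc_orient neq; rewrite axy.
Qed.

Lemma arc_total x y : x != y -> ~~ arc y x -> arc x y.
Proof. by move=> /arc_orient; case: (arc y x); rewrite ?addbF. Qed.

Lemma uniq_hamiltonian_path s :
  uniq s -> exists2 s', perm_eq s' s & sorted (@arc T) s'.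
Proof.
(* Unlike [arc], the relation [e] also holds between equal vertices, which makes it total; on
   distinct vertices the two agree. *)
pose e : rel T := fun x y => ~~ arc y x.
have e_total : total e.
  by move=> x y; rewrite /e; case: (boolP (arc y x)) => // /arc_asym ->.
move=> s_uniq; exists (sort e s); first by rewrite perm_sort.
have : uniq (sort e s) by rewrite sort_uniq.
rewrite uniq_pairwise => /pairwise_sorted s_neq.
(* Merge sort orders consecutive elements for any total relation: transitivity
   is not needed. *)
have := sort_sorted e_total s.
case: (sort e s) s_neq => //= x p; elim: p x => //= y p IHp x.
by move=> /andP[xy /IHp{}IHp] /andP[eyx /IHp ->]; rewrite arc_total.
Qed.

Lemma domination_numberP :
  exists2 S : {set T}, dominating S & #|S| = domination_number T.
Proof.
rewrite /domination_number; case: arg_minnP => [|S domS _]; last by exists S.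
by apply/forallP => v; rewrite inE.
Qed.

Lemma domination_number_le S : dominating S -> domination_number T <= #|S|.
Proof.
move=> domS; rewrite /domination_number; case: arg_minnP => [|S' _]; last exact.
by apply/forallP => v; rewrite inE.
Qed.

Lemma watchman_number_le x p :
  closed_dominating_walk x p -> watchman_number T <= size p.
Proof.
move=> xp; rewrite /watchman_number; case: ex_minnP => m _; apply.
by apply/existsP; exists x; apply/existsP; exists (in_tuple p).
Qed.

(** A closed walk of positive length ends where it starts, so it visits at most as many vertices as
    it has arcs. *)
Lemma domination_number_le_watchman :
  1 < domination_number T -> domination_number T <= watchman_number T.
Proof.
rewrite /watchman_number; case: ex_minnP => m /existsP[x /existsP[p]] + _.
case/andP=> /andP[_ /eqP lp] /domination_number_le.
rewrite cardsE => le_p gt1.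
rewrite -(size_tuple p); case: (tval p) lp le_p => [|y q] lp le_p.
  (* A walk of length 0 visits a single vertex, which [gt1] forbids from dominating. *)
  by have := leq_trans gt1 (leq_trans le_p (card_size _)); rewrite ltnn.
apply: leq_trans le_p _; apply: leq_trans (card_size (y :: q)).
apply/subset_leq_card/subsetP => z; rewrite inE => /predU1P[->|//].
by rewrite -lp /= mem_last.
Qed.

Lemma minimum_dominating_closing S u v :
    dominating S -> #|S| = domination_number T -> u \in S -> v \in S ->
  arc u v -> exists2 x, arc v x & arc x u.
Proof.
move=> domS cardS uS vS auv.
have [x /andP[]|no_x] := pickP [pred x | arc v x && arc x u]; first by exists x.
have neq : u != v by apply: contraTneq auv => ->; rewrite arc_irr.
suff /domination_number_le : dominating (S :\ v).
  by rewrite -cardS (cardsD1 v S) vS ltnn.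
apply/forallP => y; rewrite !inE; have [->|y_neq /=] := eqVneq y v.
  by apply/existsP; exists u; rewrite !inE neq uS.
case: (boolP (y \in S)) => //= yS.
have := forallP domS y; rewrite (negPf yS) => /existsP[z /andP[zS azy]].
apply/existsP; have [zv|z_neq] := eqVneq z v; last first.
  by exists z; rewrite !inE z_neq zS.
(* Here [y] is dominated by [v]. An arc from [y] to [u] would make [y] one of the vertices excluded
   by [no_x], so [u] dominates [y]. *)
exists u; rewrite !inE neq uS arc_total //.
  by apply: contraNneq yS => <-.
by have := no_x y; rewrite /= -zv azy /= => ->.
Qed.

Lemma watchman_number_le_domination :
  1 < domination_number T -> watchman_number T <= (domination_number T).+1.
Proof.
have [S domS cardS] := domination_numberP => gt1.
have [s sS s_path] := uniq_hamiltonian_path _ (enum_uniq S).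
have memS z : (z \in s) = (z \in S) by rewrite (perm_mem sS) mem_enum.
have size_s : size s = domination_number T by rewrite (perm_size sS) -cardE.
have s_uniq : uniq s by rewrite (perm_uniq sS) enum_uniq.
(* Supersets are allowed because the closed walks below repeat [u] and may pass through an extra
   vertex [x]. *)
have dom_supset s' : {subset s <= s'} -> dominating [set z in s'].
  move=> sub; apply/forallP => y; rewrite inE.
  case/orP: (forallP domS y) => [|/existsP[z /andP[zS azy]]].
    by rewrite -memS => /sub ->.
  by apply/orP; right; apply/existsP; exists z; rewrite inE azy sub ?memS.
case: s => [|u p] /= in memS sS s_path size_s s_uniq dom_supset *.
  by rewrite -size_s in gt1.
have uS : u \in S by rewrite -memS mem_head.
have vS : last u p \in S by rewrite -memS mem_last.
have uv : u != last u p.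
  have := s_uniq; case: (p) size_s => [/= size_s _|y q _ /= /andP[uq _]].
    by rewrite -size_s in gt1.
  by apply: contraNneq uq => ->; rewrite mem_last.
rewrite -size_s; case: (boolP (arc (last u p) u)) => [avu|navu].
  (* The cycle [u :: rcons p u] has as many arcs as [u :: p] has vertices, one fewer than the
     bound. *)
  rewrite -(size_rcons p u); apply/leqW/(watchman_number_le u).
  rewrite /closed_dominating_walk /closed_walk rcons_path s_path avu last_rcons.
  rewrite eqxx; apply: dom_supset => z.
  by rewrite !inE mem_rcons inE => /orP[]->; rewrite ?orbT.
have auv := arc_total _ _ uv navu.
have [x avx axu] := minimum_dominating_closing _ _ _ domS cardS uS vS auv.
(* The detour through [x] replaces the missing closing arc by two, which meets the bound exactly. *)
rewrite -(size_rcons p x) -(size_rcons _ u); apply: (watchman_number_le u).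
rewrite /closed_dominating_walk /closed_walk !rcons_path s_path !last_rcons.
rewrite avx axu eqxx; apply: dom_supset => z.
by rewrite !inE !mem_rcons !inE mem_rcons inE => /orP[]->; rewrite ?orbT.
Qed.

End TournamentWalks.

Theorem theorem4p2 (T : tournament) (hn : 3 <= #|T|)
    (hgamma : 1 < domination_number T) :
  watchman_number T = domination_number T \/
  watchman_number T = (domination_number T).+1.
Proof.
have ge := domination_number_le_watchman T hgamma.
have := watchman_number_le_domination T hgamma.
rewrite leq_eqVlt ltnS => /predU1P[->|le]; first by right.
by left; apply/eqP; rewrite eqn_leq le ge.
Qed.
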